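(* Let $\mathbf{L}\in V(\mathbb{AOL})$. For a lattice ideal $I\subseteq L$ the following are equivalent: (i) $I$ is a $V(\mathbb{AOL})$-ideal of $\mathbf{L}$. (ii) For any $a,b\in L$, if $b\in I$ and $a\wedge b^{\sim}\in I$, then $a\in I$. (iii) $I$ is closed with respect to all interpretations in $\mathbf{L}$ of the $V(\mathbb{AOL})$-ideal term (in $y,z$) $u(x,y,z)=x\wedge\Diamond(y\vee z)$; that is, $u^{\mathbf{L}}(c,a,b)\in I$ for all $c\in L$ and all $a,b\in I$.
   Context: A bounded involution lattice is an algebra $(L,\wedge,\vee,{}^{\prime},0,1)$ such that $(L,\wedge,\vee,0,1)$ is a bounded lattice, $a^{\prime\prime}=a$, and $a\leq b$ implies $b^{\prime}\leq a^{\prime}$. It is a pseudo-Kleene algebra if $a\wedge a^{\prime}\leq b\vee b^{\prime}$ for all $a,b$. A BZ-lattice is an algebra $\mathbf{L}=(L,\wedge,\vee,{}^{\prime},{}^{\sim},0,1)$ whose reduct without ${}^{\sim}$ is a pseudo-Kleene algebra and such that for all $a,b\in L$: $a\wedge a^{\sim}=0$; $a\leq a^{\sim\sim}$; $a\leq b$ implies $b^{\sim}\leq a^{\sim}$; $a^{\sim\prime}=a^{\sim\sim}$. Write $\Diamond x=x^{\sim\sim}$ and $\square x=x^{\prime\sim}$. A PBZ$^{\ast}$-lattice is a BZ-lattice satisfying $(a\wedge a^{\prime})^{\sim}\leq a^{\sim}\vee\square a$ for all $a$, and which is paraorthomodular: $a\leq b$ and $a^{\prime}\wedge b=0$ imply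 $a=b$. An antiortholattice is a PBZ$^{\ast}$-lattice $\mathbf{L}$ with $\{a\in L: a\wedge a^{\prime}=0\}=\{0,1\}$; $\mathbb{AOL}$ is the class of antiortholattices and $V(\mathbb{AOL})$ the variety it generates. A lattice ideal is a nonempty, downward closed subset closed under binary joins. For a class $\mathbb{K}$ of algebras of the same type with constant $0$, a term $p(\overrightarrow{x},\overrightarrow{y})$ is a $\mathbb{K}$-ideal term in $\overrightarrow{x}$ if $\mathbb{K}\models p(0,\ldots,0,\overrightarrow{y})\approx 0$. A nonempty subset $J$ of the universe $A$ of $\mathbf{A}\in\mathbb{K}$ is a $\mathbb{K}$-ideal of $\mathbf{A}$ if for every $\mathbb{K}$-ideal term $p(\overrightarrow{x},\overrightarrow{y})$ in $\overrightarrow{x}$, $p^{\mathbf{A}}(\overrightarrow{a},\overrightarrow{b})\in J$ whenever all entries of $\overrightarrow{a}$ are in $J$ and all entries of $\overrightarrow{b}$ are in $A$. *)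

(* Defs.v *)
(* Mathematical Components; subsets are [set] from mathcomp.classical. *)
From mathcomp Require Import all_boot.
From mathcomp Require Import classical_sets.

Set Implicit Arguments.
Unset Strict Implicit.
Unset Printing Implicit Defensive.

Declare Scope bz_scope.
Delimit Scope bz_scope with bz.
Local Open Scope bz_scope.

(* Raw algebras of type (meet, join, ', ~, 0, 1); no identities are imposed. *)
Record algebra := Algebra {
  carrier :> Type;
  meet : carrier -> carrier -> carrier;
  join : carrier -> carrier -> carrier;
  kneg : carrier -> carrier;  (* Kleene complement, a' *)
  bneg : carrier -> carrier;  (* Brouwer complement, a~ *)
  bot : carrier;
  top : carrier
}.
Arguments bot {a}.
Arguments top {a}.

Notation "x ⊓ y" := (meet x y) (at level 40, left associativity) : bz_scope.
Notation "x ⊔ y" := (join x y) (at level 50, left associativity) : bz_scope.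
Notation "x ⊑ y" := (x ⊓ y = x) (at level 70, no associativity) : bz_scope.

Definition dia (L : algebra) (x : L) : L := bneg (bneg x).
Definition box (L : algebra) (x : L) : L := bneg (kneg x).

Record bounded_lattice (L : algebra) : Prop := BoundedLattice {
  meetA : associative (@meet L);
  meetC : commutative (@meet L);
  joinA : associative (@join L);
  joinC : commutative (@join L);
  meetK : forall a b : L, a ⊓ (a ⊔ b) = a;
  joinK : forall a b : L, a ⊔ (a ⊓ b) = a;
  bot_le : forall a : L, bot ⊑ a;
  le_top : forall a : L, a ⊑ top
}.

Record bounded_involution_lattice (L : algebra) : Prop := BoundedInvolutionLattice {
  bil_lattice : bounded_lattice L;
  knegK : involutive (@kneg L);
  kneg_anti : forall a b : L, a ⊑ b -> kneg b ⊑ kneg a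
}.

Record pseudo_Kleene (L : algebra) : Prop := PseudoKleene {
  pk_bil : bounded_involution_lattice L;
  kleene : forall a b : L, (a ⊓ kneg a) ⊑ (b ⊔ kneg b)
}.

Record BZ_lattice (L : algebra) : Prop := BZLattice {
  bz_pk : pseudo_Kleene L;
  meet_bneg : forall a : L, a ⊓ bneg a = bot;
  le_bnegK : forall a : L, a ⊑ bneg (bneg a);
  bneg_anti : forall a b : L, a ⊑ b -> bneg b ⊑ bneg a;
  kneg_bneg : forall a : L, kneg (bneg a) = bneg (bneg a)
}.

Definition paraorthomodular (L : algebra) : Prop :=
  forall a b : L, a ⊑ b -> kneg a ⊓ b = bot -> a = b.

Record PBZstar_lattice (L : algebra) : Prop := PBZstarLattice {
  pbz_bz : BZ_lattice L;
  pbz_star : forall a : L, bneg (a ⊓ kneg a) ⊑ (bneg a ⊔ box a);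
  pbz_paraorthomodular : paraorthomodular L
}.

Record antiortholattice (L : algebra) : Prop := Antiortholattice {
  aol_pbz : PBZstar_lattice L;
  aol_sharp : ([set a : L | a ⊓ kneg a = bot] = [set bot; top])%classic
}.

Record homomorphism (A B : algebra) (f : A -> B) : Prop := Homomorphism {
  hom_meet : {morph f : x y / x ⊓ y};
  hom_join : {morph f : x y / x ⊔ y};
  hom_kneg : {morph f : x / kneg x};
  hom_bneg : {morph f : x / bneg x};
  hom_bot : f bot = bot;
  hom_top : f top = top
}.

Definition product (I : Type) (A : I -> algebra) : algebra :=
  @Algebra (forall i, A i)
    (fun x y i => x i ⊓ y i) (fun x y i => x i ⊔ y i)
    (fun x i => kneg (x i)) (fun x i => bneg (x i))
    (fun=> bot) (fun=> top).

(* Subalgebras are taken up to isomorphism, that is, as domains of injective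
   homomorphisms. *)
Record variety (K : algebra -> Prop) : Prop := Variety {
  variety_H : forall (A B : algebra) (f : A -> B),
    homomorphism f -> (forall y, exists x, f x = y) -> K A -> K B;
  variety_S : forall (A B : algebra) (f : A -> B),
    homomorphism f -> injective f -> K B -> K A;
  variety_P : forall (I : Type) (A : I -> algebra),
    (forall i, K (A i)) -> K (product A)
}.

Definition generated_variety (K : algebra -> Prop) (A : algebra) : Prop :=
  forall V : algebra -> Prop,
    variety V -> (forall B, K B -> V B) -> V A.

Definition V_AOL : algebra -> Prop := generated_variety antiortholattice.

Inductive term (X : Type) : Type :=
| Var of X
| Meet of term X & term X
| Join of term X & term X
| Kneg of term X
| Bneg of term X
| Bot
| Top.
Arguments Bot {X}.
Arguments Top {X}.

Fixpoint eval (A : algebra) (X : Type) (e : X -> A) (t : term X) : A :=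
  match t with
  | Var x => e x
  | Meet s t => eval e s ⊓ eval e t
  | Join s t => eval e s ⊔ eval e t
  | Kneg s => kneg (eval e s)
  | Bneg s => bneg (eval e s)
  | Bot => bot
  | Top => top
  end.

(* The two summands of the variable type are the two blocks of variables in
   p(x_1, ..., x_m, y_1, ..., y_n). *)
Definition interp (A : algebra) (m n : nat) (p : term ('I_m + 'I_n))
    (a : m.-tuple A) (b : n.-tuple A) : A :=
  eval (fun v => match v with inl i => tnth a i | inr j => tnth b j end) p.

(* p(x, y) is a K-ideal term in x, its first block of variables. *)
Definition ideal_term (K : algebra -> Prop) (m n : nat)
    (p : term ('I_m + 'I_n)) : Prop :=
  forall A : algebra, K A ->
    forall b : n.-tuple A, interp p [tuple bot | _ < m] b = bot.

(* Meaningful for A in K. *)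
Definition K_ideal (K : algebra -> Prop) (A : algebra) (J : set A) : Prop :=
  (J !=set0)%classic /\
  forall (m n : nat) (p : term ('I_m + 'I_n)), ideal_term K p ->
    forall (a : m.-tuple A) (b : n.-tuple A),
      (forall i, J (tnth a i)) -> J (interp p a b).

Record lattice_ideal (A : algebra) (J : set A) : Prop := LatticeIdeal {
  li_nonempty : (J !=set0)%classic;
  li_down : forall a b : A, a ⊑ b -> J b -> J a;
  li_join : forall a b : A, J a -> J b -> J (a ⊔ b)
}.

(* u(x, y, z) = x /\ <>(y \/ z); the ideal variables y, z form the first
   block and x the second, so u(c, a, b) is interp u_term (a, b) (c). *)
Definition u_term : term ('I_2 + 'I_1) :=
  let x := Var (inr ord0) in
  let y := Var (inl ord0) in
  let z := Var (inl ord_max) in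
  Meet x (Bneg (Bneg (Join y z))).

(* Main.v *)
(* Every Brouwer complement in an antiortholattice is sharp, so it is [top] at
   [bot] and [bot] elsewhere.  Hence [a = (a ⊓ dia b) ⊔ (a ⊓ bneg b)] holds in
   all antiortholattices, and so does [p(x, y) ⊑ dia (x_1 ⊔ ... ⊔ x_m)] for every
   ideal term [p]: both are trivial when [dia] takes the value [top], and reduce
   to [b = bot], respectively [x = bot], otherwise.  These are identities, so they
   pass to the generated variety, where they give the equivalences. *)
Require Import Defs.
From mathcomp Require Import all_boot.
From mathcomp Require Import boolp classical_sets.
Local Open Scope bz_scope.

Section Identities.
Variable X : Type.
Implicit Types s t : term X.

Lemma eval_hom {A B : algebra} {f : A -> B} : homomorphism f ->
  forall (e : X -> A) t, f (eval e t) = eval (f \o e) t.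
Proof.
case=> fM fJ fK fB f0 f1 e.
by elim=> //= [s <- t <-|s <- t <-|t <-|t <-].
Qed.

Lemma eval_product {J : Type} (A : J -> algebra) (e : X -> product A) t j :
  eval e t j = eval (fun x => e x j) t.
Proof.
by elim: t => //= [s <- t <-|s <- t <-|t <-|t <-].
Qed.

(** The easy half of Birkhoff's theorem: homomorphic images, subalgebras and products all preserve
    identities. *)
Lemma variety_identity s t :
  variety (fun A => forall e : X -> A, eval e s = eval e t).
Proof.
split=> [A B f fh fsurj hA e | A B f fh finj hB e | J A hA e].
(* A valuation in the image lifts to [A] through a section [g] of the surjection [f]. *)
- have [g fg] := choice fsurj.
  have -> : e = f \o (g \o e) by apply: funext => x /=; rewrite fg.
  by rewrite -!(eval_hom fh) hA.
- by apply: finj; rewrite !(eval_hom fh) hB.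
- by apply: functional_extensionality_dep => j; rewrite !eval_product hA.
Qed.

Lemma V_AOL_identity s t :
  (forall A, antiortholattice A -> forall e : X -> A, eval e s = eval e t) ->
  forall L, V_AOL L -> forall e : X -> L, eval e s = eval e t.
Proof.
by move=> hst L hL; apply: (hL _ (variety_identity s t)).
Qed.

End Identities.

Section BoundedLattice.
Context {L : algebra} (hL : bounded_lattice L).
Implicit Types a b : L.

Lemma meet0x a : bot ⊓ a = bot. Proof. exact: (bot_le hL). Qed.
Lemma meetx0 a : a ⊓ bot = bot. Proof. by rewrite (meetC hL) meet0x. Qed.
Lemma meetx1 a : a ⊓ top = a. Proof. exact: (le_top hL). Qed.
Lemma joinx0 a : a ⊔ bot = a. Proof. by rewrite -{1}(meetx0 a) (joinK hL). Qed.
Lemma join0x a : bot ⊔ a = a. Proof. by rewrite (joinC hL) joinx0. Qed.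

Lemma join_eq0 {a b} : a ⊔ b = bot -> a = bot /\ b = bot.
Proof.
move=> ab0; split; first by rewrite -(meetK hL a b) ab0 meetx0.
by rewrite -(meetK hL b a) (joinC hL) ab0 meetx0.
Qed.

End BoundedLattice.

Section Antiortholattice.
Context {A : algebra} (hA : antiortholattice A).
Implicit Types a : A.

Let bz : BZ_lattice A := pbz_bz (aol_pbz hA).

Lemma aol_lattice : bounded_lattice A.
Proof. exact: bil_lattice (pk_bil (bz_pk bz)). Qed.

Let lat := aol_lattice.

(** [top ⊑ dia top] forces [dia top = top], and antitonicity applied to [bot ⊑ bneg top] gives
    [dia top ⊑ bneg bot]. *)
Lemma bneg0 : bneg (bot : A) = top.
Proof.
have dia1 : bneg (bneg top) = top :> A.
  by rewrite -[RHS](le_bnegK bz) (meetC lat) (meetx1 lat).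
have := bneg_anti bz (bot_le lat (bneg top)).
by rewrite dia1 (meetC lat) (meetx1 lat).
Qed.

Lemma bneg1 : bneg (top : A) = bot.
Proof. by rewrite -[LHS](meetx1 lat) (meetC lat) (meet_bneg bz). Qed.

Lemma bneg_neq0 a : a <> bot -> bneg a = bot.
Proof.
(* Sharpness of [bneg a]: its Kleene complement is [bneg (bneg a)], which meets it in [bot]. *)
move=> a0; have : ([set bot; top] : set A)%classic (bneg a).
  by rewrite -(aol_sharp hA) /= (kneg_bneg bz) (meet_bneg bz).
case=> //= a1; case: a0.
by rewrite -(meet_bneg bz a) a1 (meetx1 lat).
Qed.

Lemma aolP a : (a = bot /\ bneg a = top) \/ (bneg a = bot).
Proof.
case: (pselect (a = bot)) => [->|/bneg_neq0]; last by right.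
by left; rewrite bneg0.
Qed.

End Antiortholattice.

Section Variety.
Context {L : algebra} (hL : V_AOL L).
Implicit Types a b c : L.

Let pair_env a b := fun i : bool => if i then a else b.

(** Membership in [V_AOL] gives access only to identities, so even the lattice laws needed for [L]
    are transferred from antiortholattices. *)
Lemma V_AOL_bot_le a : bot ⊑ a.
Proof.
apply: (@V_AOL_identity bool (Meet Bot (Var true)) Bot _ _ hL (pair_env a a)).
by move=> A hA e /=; rewrite (meet0x (aol_lattice hA)).
Qed.

Lemma V_AOL_joinx0 a : a ⊔ bot = a.
Proof.
apply: (@V_AOL_identity bool
  (Join (Var true) Bot) (Var true) _ _ hL (pair_env a a)).
by move=> A hA e /=; rewrite (joinx0 (aol_lattice hA)).
Qed.

(** In an antiortholattice one of [dia b] and [bneg b] is [bot]. *)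
Lemma V_AOL_dia_bneg a b : (a ⊓ dia b) ⊓ bneg b = bot.
Proof.
apply: (@V_AOL_identity bool
  (Meet (Meet (Var true) (Bneg (Bneg (Var false)))) (Bneg (Var false)))
  Bot _ _ hL (pair_env a b)).
move=> A hA e /=; have lat := aol_lattice hA.
by case: (aolP hA (e false)) => [[_ ->]|->];
  rewrite ?(bneg1 hA) ?(meetx0 lat) ?(meet0x lat).
Qed.

Lemma V_AOL_split a b : (a ⊓ dia b) ⊔ (a ⊓ bneg b) = a.
Proof.
apply: (@V_AOL_identity bool
  (Join (Meet (Var true) (Bneg (Bneg (Var false))))
        (Meet (Var true) (Bneg (Var false))))
  (Var true) _ _ hL (pair_env a b)).
move=> A hA e /=; have lat := aol_lattice hA.
case: (aolP hA (e false)) => [[_ ->]|->].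
  by rewrite (bneg1 hA) (meetx0 lat) (meetx1 lat) (join0x lat).
by rewrite (bneg0 hA) (meetx1 lat) (meetx0 lat) (joinx0 lat).
Qed.

Lemma V_AOL_dia_bot c : c ⊓ dia (bot ⊔ bot) = bot.
Proof.
apply: (@V_AOL_identity bool
  (Meet (Var true) (Bneg (Bneg (Join Bot Bot)))) Bot _ _ hL (pair_env c c)).
move=> A hA e /=; have lat := aol_lattice hA.
by rewrite (joinx0 lat) (bneg0 hA) (bneg1 hA) (meetx0 lat).
Qed.

End Variety.

Lemma V_AOL_antiortholattice A : antiortholattice A -> V_AOL A.
Proof. by move=> hA V _; apply. Qed.

Lemma interp_u {A : algebra} (a b c : A) :
  interp u_term [tuple a; b] [tuple c] = c ⊓ dia (a ⊔ b).
Proof. by rewrite /interp /= !(tnth_nth a). Qed.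

Lemma ideal_term_u : ideal_term V_AOL u_term.
Proof.
by move=> A hA b; rewrite /interp /= !tnth_mktuple (V_AOL_dia_bot hA).
Qed.

(** A term rather than an element, so that the bound on ideal terms is itself an identity. *)
Definition join_vars {m n : nat} (s : seq 'I_m) : term ('I_m + 'I_n) :=
  foldr (fun i t => Join (Var (inl i)) t) Bot s.

Lemma eval_join_vars0 {m n : nat} {A : algebra} (lat : bounded_lattice A)
    (e : 'I_m + 'I_n -> A) (s : seq 'I_m) :
  eval e (join_vars s) = bot -> forall i, i \in s -> e (inl i) = bot.
Proof.
elim: s => //= j s IHs /(join_eq0 lat)[ej0 /IHs es0] i.
by rewrite inE => /predU1P[->|/es0].
Qed.

Lemma lattice_ideal_join_vars {m n : nat} {A : algebra} {I : set A}
    (hI : lattice_ideal I) (e : 'I_m + 'I_n -> A) (s : seq 'I_m) :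
  I bot -> (forall i, I (e (inl i))) -> I (eval e (join_vars s)).
Proof.
by move=> I0 Ie; elim: s => //= i s; apply: (li_join hI).
Qed.

Lemma ideal_term_le_dia {m n : nat} (p : term ('I_m + 'I_n)) :
  ideal_term V_AOL p ->
  forall L, V_AOL L -> forall e : 'I_m + 'I_n -> L,
  eval e p ⊑ dia (eval e (join_vars (enum 'I_m))).
Proof.
move=> hp L hL e.
apply: (@V_AOL_identity _
  (Meet p (Bneg (Bneg (join_vars (enum 'I_m))))) p _ _ hL e).
move=> {L hL e} A hA e /=; have lat := aol_lattice hA.
case: (aolP hA (eval e (join_vars (enum 'I_m)))) => [[e0 ->]|->]; last first.
  by rewrite (bneg0 hA) (meetx1 lat).
rewrite (bneg1 hA) (meetx0 lat).
(* The join of the first block is [bot], so [e] vanishes on that block and [p] is evaluated exactly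
   as in the definition of an ideal term. *)
rewrite -(hp A (V_AOL_antiortholattice A hA) [tuple e (inr j) | j < n]).
congr (eval _ p); apply: funext => -[i|j]; rewrite tnth_mktuple //.
by rewrite (eval_join_vars0 lat _ _ e0) // mem_enum.
Qed.

Theorem proposition56 (L : algebra) (hL : V_AOL L) (I : set L)
    (hI : lattice_ideal I) :
  ideal_term V_AOL u_term /\
  [<-> K_ideal V_AOL I;
       forall a b : L, I b -> I (a ⊓ bneg b) -> I a;
       forall c a b : L, I a -> I b -> I (interp u_term [tuple a; b] [tuple c])].
Proof.
have I0 : I bot.
  have [x Ix] := li_nonempty hI.
  exact: (li_down hI (V_AOL_bot_le hL x) Ix).
split; first exact: ideal_term_u.
tfae.
- move=> [_ Iterm] a b Ib Iab.
  rewrite -(V_AOL_split hL a b); apply: (li_join hI) => //.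
  (* Padding [b] with [bot] makes [a ⊓ dia b] a value of [u_term] at two elements of [I]. *)
  rewrite -(V_AOL_joinx0 hL b) -interp_u.
  apply: Iterm; first exact: ideal_term_u.
  move=> i; rewrite (tnth_nth bot).
  by case: i => -[|[|]].
- move=> Iii c a b Ia Ib; rewrite interp_u.
  (* With [a ⊔ b] as the ideal element, the other premise of (ii) concerns [bot]. *)
  apply: (Iii _ (a ⊔ b)); first exact: (li_join hI).
  by rewrite (V_AOL_dia_bneg hL).
- move=> Iiii; split; first exact: (li_nonempty hI).
  move=> m n p hp a b Ia; rewrite /interp.
  set e := (X in eval X p).
  have Id : I (eval e (join_vars (enum 'I_m))).
    exact: lattice_ideal_join_vars.
  (* The bound turns the value of [p] into its meet with [dia] of an element of [I], again a value
     of [u_term] padded with [bot]. *)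
  rewrite -(ideal_term_le_dia p hp L hL).
  by have := Iiii (eval e p) _ _ Id I0; rewrite interp_u (V_AOL_joinx0 hL).
Qed.
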